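(* Let $\mathcal{A}\subseteq\mathcal{X}$ be such that a) $\lambda\mathcal{A}+\mathcal{R}(B)^{\succ}\subseteq\mathcal{A}$ for all $\lambda\geq 0$ and all $B\in\mathcal{B}^{\varnothing}$; b) $\mathcal{R}(B)^{\prec}\cap\mathcal{A}=\emptyset$ for all $B\in\mathcal{B}^{\varnothing}$; c) $(\mathcal{R}(B_1)\cap\mathcal{A})+(\mathcal{R}(B_2)\cap\mathcal{A})\subseteq\mathcal{R}(B_1\vee B_2)\setminus\mathcal{R}(B_1\vee B_2)^{\prec}$ for all $B_1,B_2\in\mathcal{B}^{\varnothing}$. Define, for all $X|B\in\mathcal{D}_{LIN}$, $$\underline{P}(X|B)=\sup\{x\in\mathbb{R}:B(X-x)\in\mathcal{A}\}.$$ Then $\underline{P}$ is $2$-coherent on $\mathcal{D}_{LIN}$.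
   Context: Fix a partition $\mathbb{P}$ of the sure event $\Omega$ into atoms $\omega$. A gamble is a bounded function $X:\mathbb{P}\to\mathbb{R}$. Events are subsets of $\mathbb{P}$, identified with their indicators; $\wedge,\vee,\neg$ denote intersection, union, complement; $\varnothing$ is the impossible event. For a gamble $X$ and an event $B\neq\varnothing$, the conditional gamble $X|B$ is the restriction of $X$ to $B$; thus $\sup\{X|B\}=\sup_{\omega\in B}X(\omega)$ and $\inf\{X|B\}=\inf_{\omega\in B}X(\omega)$. Let $\mathcal{X}$ be a linear space of gambles and $\mathcal{B}\subset\mathcal{X}$ a set of (indicators of) events, with $\Omega\in\mathcal{B}$ and $BX\in\mathcal{X}$ for all $B\in\mathcal{B}$, $X\in\mathcal{X}$. Put $\mathcal{B}^{\varnothing}=\mathcal{B}\setminus\{\varnothing\}$ and $\mathcal{D}_{LIN}=\{X|B: X\in\mathcal{X}, B\in\mathcal{B}^{\varnothing}\}$. For a non-impossible event $B$ (in particular for $B\in\mathcal{B}^{\varnothing}$, and for unions $B_1\vee B_2$ of such events) let $\mathcal{R}(B)=\{X\in\mathcal{X}:BX=X\}$, $\mathcal{R}(B)^{\succ}=\{X\in\mathcal{R}(B):\inf\{X|B\}>0\}$, $\mathcal{R}(B)^{\prec}=\{X\in\mathcal{R}(B):\sup\{X|B\}<0\}$. Sums of sets are Minkowski sums: $\lambda\mathcal{S}+\mathcal{T}=\{\lambda X+Y:X\in\mathcal{S},Y\in\mathcal{T}\}$. $\underline{P}:\mathcal{D}\to\mathbb{R}$ is $2$-coherent on $\mathcal{D}$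 iff for all $X_0|B_0,X_1|B_1\in\mathcal{D}$, all $s_1\geq 0$ and all $s_0\in\mathbb{R}$, setting $S(\underline{s})=\bigvee\{B_i:s_i\neq 0,\ i=0,1\}$ and $\underline{G}_2=s_1B_1(X_1-\underline{P}(X_1|B_1))-s_0B_0(X_0-\underline{P}(X_0|B_0))$, one has $\sup\{\underline{G}_2|S(\underline{s})\}\geq 0$ whenever $S(\underline{s})\neq\varnothing$.
   Formalization: The set A is additionally assumed to be nonempty: for A = ∅ conditions a)–c) hold trivially, but the supremum defining P(X|B) is that of the empty set, so P is not real-valued and the claim has no meaning. *)

(* Defs.v *)
From HB Require Import structures.
From mathcomp Require Import all_boot all_order all_algebra.
From mathcomp Require Import all_classical all_reals all_analysis.

Set Implicit Arguments.
Unset Strict Implicit.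
Unset Printing Implicit Defensive.

Import Order.TTheory GRing.Theory Num.Theory numFieldNormedType.Exports.
Local Open Scope classical_set_scope.
Local Open Scope ring_scope.

Section Setting.
Context {T : Type} {R : realType}.

(* [T] is the set of atoms of the partition; events are subsets of [T]. *)
Implicit Types (X Y : T -> R) (B : set T) (A S : set (T -> R)).

Definition gamble X : Prop := bounded_fun X.

(* A conditional gamble is a restriction of a gamble: a real function whose
   domain is the conditioning event.  Two gambles that agree on [B] hence give
   the same conditional gamble given [B].  That [B] is not impossible is
   required by the domain of the prevision, see [DLIN]. *)
Record cgamble := CGamble { cevent : set T; cvalue : cevent -> R }.
Arguments cvalue : clear implicits.

Definition cond X B : cgamble := CGamble (sigL B X).

Definition csup X B : R := sup [set X w | w in B].
Definition cinf X B : R := inf [set X w | w in B].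

Definition is_setting (calX : set (T -> R)) (calB : set (set T)) : Prop :=
  [/\ calX `<=` gamble,
      calX 0 /\
        (forall (a : R) X Y, calX X -> calX Y -> calX (a *: X + Y)),
      (forall B, calB B -> calX \1_B),
      calB setT
    & forall B X, calB B -> calX X -> calX (\1_B * X)].

Definition nonimpossible (calB : set (set T)) : set (set T) :=
  calB `\ set0.

Definition DLIN (calX : set (T -> R)) (calB : set (set T)) : set cgamble :=
  [set cond X B | X in calX & B in nonimpossible calB].

Definition RB (calX : set (T -> R)) B : set (T -> R) :=
  [set X | calX X /\ \1_B * X = X].
Definition RBpos (calX : set (T -> R)) B : set (T -> R) :=
  [set X | RB calX B X /\ 0 < cinf X B].
Definition RBneg (calX : set (T -> R)) B : set (T -> R) :=
  [set X | RB calX B X /\ csup X B < 0].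

Definition minkowski_sum S S' : set (T -> R) := [set X + Y | X in S & Y in S'].
Definition scale_set (l : R) S : set (T -> R) := [set l *: X | X in S].

(* Suprema in [R] are total, with value 0 outside of the nonempty and bounded
   case.  As [gain] is a combination of gambles, and the supremum is taken over
   a nonempty event, this default value is never used here. *)
Definition two_coherent (D : set cgamble) (P : cgamble -> R) : Prop :=
  forall X0 B0 X1 B1 (s0 s1 : R),
    gamble X0 -> gamble X1 -> D (cond X0 B0) -> D (cond X1 B1) -> 0 <= s1 ->
    let Su := [set w | s0 != 0 /\ B0 w] `|` [set w | s1 != 0 /\ B1 w] in
    let gain := s1 *: (\1_B1 * (X1 - cst (P (cond X1 B1))))
              - s0 *: (\1_B0 * (X0 - cst (P (cond X0 B0)))) in
    Su !=set0 -> 0 <= csup gain Su.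

(* ['valL_0] extends a function on [cevent c] by 0, so for [c = cond X B] the
   gamble below is the product of the indicator of [B] and [X - x]: see
   [prices_cond]. *)
Definition prices A (c : cgamble) : set R :=
  [set x | A ('valL_0 (fun w => cvalue c w - x))].

Definition lower_prevision A (c : cgamble) : R := sup (prices A c).

Lemma prices_cond A X B :
  prices A (cond X B) = [set x | A (\1_B * (X - cst x))].
Proof.
apply/seteqP; suff e x : 'valL_0 (fun w : B => X (val w) - x) =
    \1_B * (X - cst x) by split=> x /=; rewrite -e.
have -> : (fun w : B => X (val w) - x) = sigL B (X - cst x) by [].
have -> : 'valL_0 (sigL B (X - cst x)) = patch (fun=> 0) B (X - cst x).
  exact: (congr1 (fun f => f (X - cst x)) (@sigLK T R 0 B)).
apply/funext => w; rewrite /patch.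
have -> : (\1_B * (X - cst x)) w = \1_B w * (X - cst x) w by [].
rewrite indicE.
by case: ifP => _; rewrite ?mul1r ?mul0r.
Qed.

End Setting.

Arguments cgamble : clear implicits.

(* Main.v *)
(* The decisive case is a gain s1 W - s0 Z, with W = B1 (X1 - P1 + e) in A and
   Z = B0 (X0 - P0 - e), that is uniformly negative on B0 \/ B1.  One would
   conclude that Z lies in A because s0 Z exceeds s1 W uniformly on B0 \/ B1,
   but (a) only allows adding gambles that are uniformly positive on an event
   of calB, and B0 \/ B1 need not be one.  Since W is uniformly negative on
   B1 \ B0, it can first be raised by an element of R(B1)^> that cancels it
   there; the result vanishes outside B0, and Z is then reached by adding an
   element of R(B0)^>.  This contradicts the definition of P0 as a supremum.
   The other signs of s0 follow from (b) and (c). *)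
Require Import Defs.
From mathcomp Require Import all_boot all_order all_algebra.
From mathcomp Require Import all_classical all_reals all_analysis.
From mathcomp Require Import ring lra.
Import Order.TTheory GRing.Theory Num.Theory numFieldNormedType.Exports.
Local Open Scope classical_set_scope.
Local Open Scope ring_scope.

(** * Bets on an event, and suprema of definite sign *)

Section Conditional.
Context {T : Type} {R : realType}.
Implicit Types (X Y : T -> R) (B C : set T) (calX : set (T -> R)).

Definition bet B X (x : R) : T -> R := \1_B * (X - cst x).

Lemma indic_in B w : B w -> \1_B w = 1 :> R.
Proof. by move=> Bw; rewrite indicE mem_set. Qed.

Lemma indic_out B w : ~ B w -> \1_B w = 0 :> R.
Proof. by move=> Bw; rewrite indicE memNset. Qed.

Lemma bet_in B X x w : B w -> bet B X x w = X w - x.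
Proof. by move=> Bw; rewrite -[LHS]/(\1_B w * (X w - x)) indic_in // mul1r. Qed.

Lemma bet_out B X x w : ~ B w -> bet B X x w = 0.
Proof. by move=> Bw; rewrite -[LHS]/(\1_B w * (X w - x)) indic_out // mul0r. Qed.

(** The bound is stated at every atom, including those outside [B] where both bets vanish, so that
    it can be used on a union of two events. *)
Lemma bet_shift B X x y w : x <= y -> bet B X x w <= bet B X y w + (y - x).
Proof.
move=> xy; case: (pselect (B w)) => Bw; first by rewrite !bet_in //; lra.
by rewrite !bet_out //; lra.
Qed.

(** [prices] sees only the conditional gamble; taken with a singleton in place of [A], it identifies
    the bet. *)
Lemma cond_bet_inj X Y B C x : cond X B = cond Y C -> bet B X x = bet C Y x.
Proof.
move=> e; have : prices [set bet C Y x] (cond X B) x by rewrite e prices_cond.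
by rewrite prices_cond.
Qed.

Lemma csup_lt0 X B : csup X B < 0 ->
  exists2 d : R, 0 < d & forall w, B w -> X w <= - d.
Proof.
move=> s0; exists (- csup X B) => [|w Bw]; first by rewrite oppr_gt0.
rewrite opprK; apply: ub_le_sup; last by exists w.
(* In the empty or unbounded case [sup] takes the value 0, which contradicts the negative sign. *)
case: (pselect (has_sup [set X w | w in B])) => [[]//|/sup_out e].
by move: s0; rewrite /csup e ltxx.
Qed.

Lemma lt0_csup X B (d : R) : B !=set0 -> 0 < d ->
  (forall w, B w -> X w <= - d) -> csup X B < 0.
Proof.
move=> [w0 Bw0] d0 h; apply: (@le_lt_trans _ _ (- d)); last by rewrite oppr_lt0.
by apply: ge_sup; [exists (X w0); exists w0|move=> _ [w Bw <-]; apply: h].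
Qed.

Lemma gt0_cinf X B (d : R) : B !=set0 -> 0 < d ->
  (forall w, B w -> d <= X w) -> 0 < cinf X B.
Proof.
move=> [w0 Bw0] d0 h; apply: (lt_le_trans d0).
by apply: lb_le_inf; [exists (X w0); exists w0|move=> _ [w Bw <-]; apply: h].
Qed.

Lemma RB_out calX B X w : RB calX B X -> ~ B w -> X w = 0.
Proof.
by move=> [_ <-] Bw; rewrite -[LHS]/(\1_B w * X w) indic_out // mul0r.
Qed.

Lemma RBI calX B X : calX X -> (forall w, ~ B w -> X w = 0) -> RB calX B X.
Proof.
move=> XX h; split => //; apply/funext => w.
rewrite -[LHS]/(\1_B w * X w).
case: (pselect (B w)) => Bw; first by rewrite indic_in // mul1r.
by rewrite indic_out // mul0r h.
Qed.

End Conditional.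

Section TwoCoherence.
Context {T : Type} {R : realType}.
Context {calX : set (T -> R)} {calB : set (set T)} {A : set (T -> R)}.
Context (hsetting : is_setting calX calB).
Context (hA : A `<=` calX).
Context (hA0 : A !=set0).
Context (ha : forall (l : R) (B : set T), 0 <= l -> nonimpossible calB B ->
  minkowski_sum (scale_set l A) (RBpos calX B) `<=` A).
Context (hb : forall B : set T, nonimpossible calB B ->
  RBneg calX B `&` A = set0).
Context (hc : forall B1 B2 : set T,
  nonimpossible calB B1 -> nonimpossible calB B2 ->
  minkowski_sum (RB calX B1 `&` A) (RB calX B2 `&` A)
    `<=` RB calX (B1 `|` B2) `\` RBneg calX (B1 `|` B2)).
Implicit Types (X Y W Z : T -> R) (B : set T) (l s t x d : R).

(** * Closure properties of the space of gambles *)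

Lemma nonimpossible_nonempty B : nonimpossible calB B -> B !=set0.
Proof. by move=> [_ Bn]; apply/set0P/eqP. Qed.

Lemma calX_scale l X : calX X -> calX (l *: X).
Proof.
case: hsetting => _ [h0 hl] _ _ _ XX.
by rewrite -[_ *: _]addr0; exact: hl.
Qed.

Lemma calX_add X Y : calX X -> calX Y -> calX (X + Y).
Proof.
case: hsetting => _ [h0 hl] _ _ _ XX XY.
by rewrite -[X]scale1r; exact: hl.
Qed.

Lemma calX_sub X Y : calX X -> calX Y -> calX (X - Y).
Proof.
move=> XX XY; apply: calX_add => //.
by rewrite -scaleN1r; exact: calX_scale.
Qed.

Lemma calX_indic B : nonimpossible calB B -> calX \1_B.
Proof. by case: hsetting => _ _ h _ _ [/h]. Qed.

Lemma calX_indicM B X : nonimpossible calB B -> calX X -> calX (\1_B * X).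
Proof. by case: hsetting => _ _ _ _ h [BB _]; exact: h. Qed.

Lemma RB_bet B X l x : nonimpossible calB B -> calX X ->
  RB calX B (l *: bet B X x).
Proof.
move=> BB XX; apply: RBI => [|w Bw].
  have -> : bet B X x = \1_B * X - x *: \1_B.
    apply/funext => w.
    have -> : (\1_B * X - x *: \1_B) w = \1_B w * X w - x * \1_B w by [].
    by rewrite -[LHS]/(\1_B w * (X w - x)); ring.
  apply: calX_scale; apply: calX_sub; first exact: calX_indicM.
  exact/calX_scale/calX_indic.
by rewrite -[LHS]/(l * bet B X x w) bet_out // mulr0.
Qed.

(** * Membership in [A] derived from (a) and (b) *)

Lemma A_add l W B Z d : 0 <= l -> A W -> nonimpossible calB B ->
  RB calX B Z -> 0 < d -> (forall w, B w -> d <= Z w) -> A (l *: W + Z).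
Proof.
move=> l0 AW BB ZB d0 h; apply: (ha _ _ l0 BB).
exists (l *: W); first by exists W.
exists Z => //; split=> //.
exact: (gt0_cinf _ _ _ (nonimpossible_nonempty _ BB) d0 h).
Qed.

(** With factor 0, condition (a) puts the uniformly positive gambles on [B] into [A] as soon as [A]
    has a member. *)
Lemma A_pos B Z d : nonimpossible calB B -> RB calX B Z -> 0 < d ->
  (forall w, B w -> d <= Z w) -> A Z.
Proof.
case: hA0 => W AW BB ZB d0 h; rewrite -[Z]add0r -(scale0r W).
exact: (A_add _ _ _ _ _ (lexx 0) AW BB ZB d0 h).
Qed.

Lemma A_neg B Z d : nonimpossible calB B -> RB calX B Z -> 0 < d ->
  (forall w, B w -> Z w <= - d) -> ~ A Z.
Proof.
move=> BB ZB d0 h AZ; suff : (RBneg calX B `&` A) Z by rewrite hb.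
split=> //; split=> //.
exact: (lt0_csup _ _ _ (nonimpossible_nonempty _ BB) d0 h).
Qed.

Lemma A_dominates B0 B1 W Z l d :
  nonimpossible calB B0 -> nonimpossible calB B1 ->
  RB calX B0 Z -> RB calX B1 W -> A W -> 0 <= l -> 0 < d ->
  (forall w, (B0 `|` B1) w -> l * W w + d <= Z w) -> A Z.
Proof.
move=> N0 N1 ZB WB AW l0 d0 h.
(* [V] is [l *: W] cancelled on [B1 \ B0] and raised by [d / 2] on [B0 & B1]. *)
pose V := \1_B0 * (l *: W + (d / 2) *: \1_B1).
have VE w : V w = \1_B0 w * (l * W w + d / 2 * \1_B1 w) by [].
have XV : calX V.
  apply: calX_indicM => //; apply: calX_add; first exact/calX_scale/hA.
  exact/calX_scale/calX_indic.
have AV : A V.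
  have -> : V = l *: W + (V - l *: W) by rewrite addrC subrK.
  apply: (A_add _ _ B1 _ (d / 2)) => //; [|lra|move=> w B1w].
    apply: RBI => [|w B1w]; first by apply: calX_sub => //; exact/calX_scale/hA.
    rewrite -[LHS]/(V w - l * W w) VE (RB_out _ _ _ _ WB B1w) (indic_out B1) //.
    by ring.
  rewrite -[X in _ <= X]/(V w - l * W w) VE (indic_in B1) //.
  have := h w (or_intror B1w).
  case: (pselect (B0 w)) => B0w; first by rewrite (indic_in B0) //; lra.
  (* On [B1] outside [B0], [Z] vanishes, so [h] forces [l * W w <= - d], and cancelling [l *: W]
     there is a raise of at least [d]. *)
  by rewrite (indic_out B0) // (RB_out _ _ _ _ ZB B0w); lra.
(* On [B0] the gap [Z - V] is at least [d / 2]: inside [B1] the raise has used half of [d], and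
   outside [B1] both [W] and [V] vanish. *)
rewrite -[Z](subrK V) addrC -[V in V + _]scale1r.
apply: (A_add _ _ B0 _ (d / 2)) => //; [|lra|move=> w B0w].
  apply: RBI => [|w B0w]; first by apply: calX_sub => //; exact: ZB.1.
  by rewrite -[LHS]/(Z w - V w) VE (RB_out _ _ _ _ ZB B0w) indic_out //; ring.
rewrite -[X in _ <= X]/(Z w - V w) VE (indic_in B0) //.
have := h w (or_introl B0w).
case: (pselect (B1 w)) => B1w; first by rewrite (indic_in B1) //; lra.
by rewrite (indic_out B1) // (RB_out _ _ _ _ WB B1w); lra.
Qed.

(** * The supremum of the admissible prices *)

Local Notation P X B := (lower_prevision A (cond X B)).

(** A price well below the values of [X] gives a uniformly positive bet, which lies in [A]; a price
    above them gives a uniformly negative one, excluded by (b). *)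
Lemma has_sup_prices B X : nonimpossible calB B -> calX X ->
  has_sup (prices A (cond X B)).
Proof.
move=> BB XX; rewrite prices_cond.
have [M M0 hM] : exists2 M : R, 0 <= M & forall w, `|X w| <= M.
  case: hsetting => /(_ _ XX) [M [_ hM]] _ _ _ _.
  (* Boundedness holds for every number strictly beyond [M]; this one is also nonnegative. *)
  exists (`|M| + 1) => [|w]; first by rewrite addr_ge0.
  by apply: (hM (`|M| + 1)); rewrite ?ltr_pwDr // ler_norm.
have RBb x : RB calX B (bet B X x).
  by rewrite -[bet B X x]scale1r; exact: RB_bet.
split.
  exists (- M - 1); apply: (A_pos B _ 1) => //; [exact: RBb|move=> w Bw].
  by rewrite [leRHS]bet_in //; have := hM w; rewrite ler_norml => /andP[]; lra.
exists (M + 1) => x; apply: contraPT; rewrite -ltNge => Mx.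
apply: (A_neg B _ (x - M)) => //; [exact: RBb|lra|move=> w Bw].
by rewrite [leLHS]bet_in //; have := hM w; rewrite ler_norml => /andP[]; lra.
Qed.

(** Some admissible price [y] exceeds [x]; going down from [y] to [x] adds the constant
    [l * (y - x)] on [B], which (a) allows. *)
Lemma A_below B X l x : nonimpossible calB B -> calX X -> 0 < l ->
  x < P X B -> A (l *: bet B X x).
Proof.
move=> BB XX l0 /(sup_gt (has_sup_prices _ _ BB XX).1) [y].
rewrite prices_cond => Ay xy.
have e w : (l *: bet B X x - l *: bet B X y) w =
    l * bet B X x w - l * bet B X y w by [].
rewrite -[l *: bet B X x](subrK (l *: bet B X y)) addrC.
apply: (A_add _ _ B _ (l * (y - x))) => //; first exact: ltW.
- apply: RBI => [|w Bw]; last by rewrite e !bet_out //; ring.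
  by apply: calX_sub; apply: (RB_bet _ _ _ _ BB XX).1.
- by rewrite mulr_gt0 // subr_gt0.
- by move=> w Bw; rewrite e !bet_in //; lra.
Qed.

Lemma A_above B X x : nonimpossible calB B -> calX X -> P X B < x ->
  ~ A (bet B X x).
Proof.
move=> BB XX Px Ax; move: Px; rewrite ltNge => /negP; apply.
by apply: ub_le_sup; [exact: (has_sup_prices _ _ BB XX).2|rewrite prices_cond].
Qed.

(** * Gains of one or two bets, by the signs of the stakes *)

Lemma single_coherent B X s d : nonimpossible calB B -> calX X ->
  0 < s -> 0 < d -> ~ (forall w, B w -> s * bet B X (P X B) w <= - d).
Proof.
(* The price [P X B] need not be admissible, but [P X B - e] is. As [s * e = d / 2], half of the
   margin survives and contradicts (b). *)
move=> BB XX s0 d0 h; pose e := d / 2 / s.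
have e0 : 0 < e by rewrite !divr_gt0.
have se : s * e = d / 2 by rewrite mulrC divfK // gt_eqF.
apply: (A_neg B (s *: bet B X (P X B - e)) (d / 2)) => //.
- exact: RB_bet.
- by lra.
- move=> w Bw; rewrite -[X in X <= _]/(s * bet B X (P X B - e) w) bet_in //.
  by have := h w Bw; rewrite bet_in //; lra.
- by apply: A_below => //; lra.
Qed.

(** Lowering both prices by [e] brings the two bets into [A] at a total cost of at most
    [(s + t) * e = d / 2]; their sum then violates (c). *)
Lemma sum_coherent B1 B2 X1 X2 s t d :
  nonimpossible calB B1 -> nonimpossible calB B2 -> calX X1 -> calX X2 ->
  0 < s -> 0 < t -> 0 < d ->
  ~ (forall w, (B1 `|` B2) w ->
       s * bet B1 X1 (P X1 B1) w + t * bet B2 X2 (P X2 B2) w <= - d).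
Proof.
move=> N1 N2 XX1 XX2 s0 t0 d0 h; pose e := d / 2 / (s + t).
have st0 : 0 < s + t by rewrite addr_gt0.
have e0 : 0 < e by rewrite !divr_gt0.
have ste : (s + t) * e = d / 2 by rewrite mulrC divfK // gt_eqF.
have se : 0 < s * e by rewrite mulr_gt0.
have te : 0 < t * e by rewrite mulr_gt0.
pose W1 := s *: bet B1 X1 (P X1 B1 - e).
pose W2 := t *: bet B2 X2 (P X2 B2 - e).
have W1P : (RB calX B1 `&` A) W1.
  by split; [exact: RB_bet|apply: A_below => //; lra].
have W2P : (RB calX B2 `&` A) W2.
  by split; [exact: RB_bet|apply: A_below => //; lra].
have [] : (RB calX (B1 `|` B2) `\` RBneg calX (B1 `|` B2)) (W1 + W2).
  by apply: hc => //; exists W1 => //; exists W2.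
move=> RW; apply; split=> //.
have [w0 B1w0] := nonimpossible_nonempty _ N1.
apply: (lt0_csup _ _ (d / 2)); [by exists w0; left|lra|move=> w Bw].
rewrite -[X in X <= _]/(s * bet B1 X1 (P X1 B1 - e) w +
  t * bet B2 X2 (P X2 B2 - e) w).
have le1 : P X1 B1 - e <= P X1 B1 by lra.
have le2 : P X2 B2 - e <= P X2 B2 by lra.
have := h w Bw; have := ler_wpM2l (ltW s0) (bet_shift B1 X1 _ _ w le1).
by have := ler_wpM2l (ltW t0) (bet_shift B2 X2 _ _ w le2); lra.
Qed.

Lemma sell_coherent B X s d : nonimpossible calB B -> calX X ->
  0 < s -> 0 < d -> ~ (forall w, B w -> - (s * bet B X (P X B) w) <= - d).
Proof.
move=> BB XX s0 d0 h; pose e := d / 2 / s.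
have e0 : 0 < e by rewrite !divr_gt0.
have es : e * s = d / 2 by rewrite divfK // gt_eqF.
apply: (A_above B X (P X B + e)) => //; first by lra.
(* By [h] the bet at [P X B] is at least [2 * e] on [B]; raising the price by [e] leaves [e]. *)
apply: (A_pos B _ e) => //.
  by rewrite -[bet B X _]scale1r; exact: RB_bet.
move=> w Bw; have := h w Bw; rewrite !bet_in // => hw.
by rewrite -(ler_pM2r s0); lra.
Qed.

Lemma diff_coherent B0 B1 X0 X1 s t d :
  nonimpossible calB B0 -> nonimpossible calB B1 -> calX X0 -> calX X1 ->
  0 < s -> 0 < t -> 0 < d ->
  ~ (forall w, (B0 `|` B1) w ->
       t * bet B1 X1 (P X1 B1) w - s * bet B0 X0 (P X0 B0) w <= - d).
Proof.
move=> N0 N1 XX0 XX1 s0 t0 d0 h; pose e := d / 2 / (s + t).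
have st0 : 0 < s + t by rewrite addr_gt0.
have e0 : 0 < e by rewrite !divr_gt0.
have ste : (s + t) * e = d / 2 by rewrite mulrC divfK // gt_eqF.
have se : 0 < s * e by rewrite mulr_gt0.
have te : 0 < t * e by rewrite mulr_gt0.
have RBb B X x : nonimpossible calB B -> calX X -> RB calX B (bet B X x).
  by move=> *; rewrite -[bet B X x]scale1r; exact: RB_bet.
apply: (A_above B0 X0 (P X0 B0 + e)) => //; first by lra.
(* After division by [s] the margin in [h] is [d / s]; the two price shifts use at most
   [(s + t) * e / s], which is half of it. *)
apply: (A_dominates B0 B1 (bet B1 X1 (P X1 B1 - e)) _ (t / s) (d / 2 / s)) => //.
- exact: RBb.
- exact: RBb.
- by rewrite -[bet B1 X1 _]scale1r; apply: A_below => //; lra.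
- by rewrite ltW // divr_gt0.
- by rewrite !divr_gt0.
move=> w Bw; rewrite -(ler_pM2r s0) mulrDl divfK ?gt_eqF // mulrAC divfK ?gt_eqF //.
have le1 : P X1 B1 - e <= P X1 B1 by lra.
have le0 : P X0 B0 <= P X0 B0 + e by lra.
have := h w Bw; have := ler_wpM2l (ltW t0) (bet_shift B1 X1 _ _ w le1).
by have := ler_wpM2l (ltW s0) (bet_shift B0 X0 _ _ w le0); lra.
Qed.

End TwoCoherence.

Theorem proposition17 (T : Type) (R : realType)
    (calX : set (T -> R)) (calB : set (set T)) (A : set (T -> R))
    (hsetting : is_setting calX calB)
    (hA : A `<=` calX) (hA0 : A !=set0)
    (ha : forall (l : R) (B : set T), 0 <= l -> nonimpossible calB B ->
       minkowski_sum (scale_set l A) (RBpos calX B) `<=` A)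
    (hb : forall B : set T, nonimpossible calB B ->
       RBneg calX B `&` A = set0)
    (hc : forall B1 B2 : set T,
       nonimpossible calB B1 -> nonimpossible calB B2 ->
       minkowski_sum (RB calX B1 `&` A) (RB calX B2 `&` A)
         `<=` RB calX (B1 `|` B2) `\` RBneg calX (B1 `|` B2)) :
  (forall c : cgamble T R, DLIN calX calB c -> has_sup (prices A c)) /\
  two_coherent (DLIN calX calB) (lower_prevision A).
Proof.
split=> [_ [X XX [B BB <-]]|]; first exact: (has_sup_prices hsetting hA0 ha hb).
move=> Y0 C0 Y1 C1 s0 s1 _ _ [X0 XX0 [B0 N0 e0]] [X1 XX1 [B1 N1 e1]] s1_ge0 Su.
(* The representatives [Y0] and [Y1] need not lie in [calX]. Equal conditional gambles have the same
   event and the same bets, so [X0] and [X1] can replace them. *)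
have eB0 : B0 = C0 := congr1 (@cevent T R) e0.
have eB1 : B1 = C1 := congr1 (@cevent T R) e1.
rewrite -[_ * (Y0 - _)]/(bet C0 Y0 _) -[_ * (Y1 - _)]/(bet C1 Y1 _).
rewrite -(cond_bet_inj _ _ _ _ _ e0) -(cond_bet_inj _ _ _ _ _ e1) -e0 -e1.
rewrite /Su -eB0 -eB1 {Su e0 e1 eB0 eB1 Y0 Y1 C0 C1} => Su0.
rewrite leNgt; apply/negP => /csup_lt0 [d d0 h].
pose Q X B := lower_prevision A (cond X B).
have {}h w : (s0 != 0 /\ B0 w) \/ (s1 != 0 /\ B1 w) ->
  s1 * bet B1 X1 (Q X1 B1) w - s0 * bet B0 X0 (Q X0 B0) w <= - d := h w.
(* An event counts in the supremum only if its stake is nonzero, so vanishing stakes leave a single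
   bet, or an empty event if both vanish. *)
have [s1z|s1n] := eqVneq s1 0.
  have hs w : s0 != 0 -> B0 w -> - (s0 * bet B0 X0 (Q X0 B0) w) <= - d.
    by move=> s0n Bw; have := h w (or_introl (conj s0n Bw)); rewrite s1z; lra.
  have [s0_lt0|s0_gt0|s0z] := ltgtP s0 0.
  - apply: (single_coherent hsetting hA0 ha hb B0 X0 (- s0) d) => //.
      by rewrite oppr_gt0.
    by move=> w Bw; rewrite mulNr; apply: hs; rewrite ?lt_eqF.
  - apply: (sell_coherent hsetting hA0 ha hb B0 X0 s0 d) => // w Bw.
    by apply: hs; rewrite ?gt_eqF.
  - by case: Su0 => w [] []; rewrite ?s0z ?s1z eqxx.
have s1_gt0 : 0 < s1 by rewrite lt0r s1n.
have [s0_lt0|s0_gt0|s0z] := ltgtP s0 0.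
(* A negative [s0] turns the sale into a purchase with stake [- s0]. *)
- apply: (sum_coherent hsetting hA0 ha hb hc B0 B1 X0 X1 (- s0) s1 d) => //.
    by rewrite oppr_gt0.
  move=> w Bw; rewrite mulNr addrC; apply: h.
  by case: Bw => ?; [left; rewrite lt_eqF|right].
- apply: (diff_coherent hsetting hA hA0 ha hb B0 B1 X0 X1 s0 s1 d) => // w Bw.
  by apply: h; case: Bw => ?; [left; rewrite gt_eqF|right].
- apply: (single_coherent hsetting hA0 ha hb B1 X1 s1 d) => // w Bw.
  by have := h w (or_intror (conj s1n Bw)); rewrite s0z mul0r subr0.
Qed.
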